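(* Let $(I_j : j\in\mathbb{Z})$ be a family of independent $\{0,1\}$-valued random variables with $p_j=\mathbb{P}(I_j=1)=1-\mathbb{P}(I_j=0)$. Suppose that there exist constants $c>0$ and $\alpha>1$ for which $p_n\sim c\,n^{-\alpha}$ as $n\to\infty$. Let $Z=\sum_{j\ge 0} I_j$. Then $$\frac{1}{z\log z}\,\log \mathbb{P}(Z>z)\to -\alpha$$ as $z\to\infty$.
   Context: $a_n\sim b_n$ means $a_n/b_n\to 1$. The limit is over real $z\to\infty$. *)

(* Defs.v *)
From HB Require Import structures.
From mathcomp Require Export all_boot all_order all_algebra finmap.
From mathcomp Require Export all_classical all_reals all_analysis.
Export numFieldNormedType.Exports.
Export Order.TTheory GRing.Theory Num.Theory.

Set Implicit Arguments.
Unset Strict Implicit.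
Unset Printing Implicit Defensive.

Local Open Scope classical_set_scope.
Local Open Scope ring_scope.

(* Mutual independence: the product rule over every finite subfamily.  The
   empty subfamily only contributes [P setT = 1]. *)
Definition independent_RVs (R : realType) (d d' : measure_display)
    (T : measurableType d) (T' : measurableType d') (P : probability T R)
    (D : choiceType) (X : D -> {RV P >-> T'}) : Prop :=
  forall (J : {fset D}) (B : D -> set T'),
    (forall j, j \in J -> measurable (B j)) ->
    P (\bigcap_(j in [set` J]) (X j @^-1` B j)) =
      (\prod_(j <- J) P (X j @^-1` B j))%E.

(* [a_n ~ b_n] as [n] tends to infinity, in the sense a_n / b_n --> 1. *)
Definition asymp_equiv (R : realType) (a b : nat -> R) : Prop :=
  a n / b n @[n --> \oo] --> (1 : R).

(* Main.v *)
Require Import Defs.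
From mathcomp Require Import ring lra.

(**
Put m = floor(z) + 1, so that Z > z means that at least m of the trials
succeed.

Lower bound: it suffices that m consecutive trials N, ..., N + m - 1 succeed,
which has probability at least (c/2 * (2z)^-alpha)^m.

Upper bound: summing over the position of the last success shows, by induction,
that k successes among independent trials of total mean S have probability at
most S^k / k! <= (e S / k)^k. At least m - n of the trials from index n on
succeed, and those have total mean O(n^(1 - alpha)); with n of order eps z and
k about (1 - 2 eps) z, both n and k are of order z and
(n^(1 - alpha) / k)^k = z^(- alpha k + o(k)).

Hence log P(Z > z) lies between theta z (L - alpha log z) for theta slightly
above and slightly below 1.
*)

Set Implicit Arguments.
Unset Strict Implicit.
Unset Printing Implicit Defensive.
Local Open Scope classical_set_scope.
Local Open Scope ring_scope.

(** * Elementary inequalities for powers and factorials *)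

(** A single term of the exponential series at [k] gives [k^k / k! <= e^k]. *)
Lemma expr_div_fact_le (R : realType) (s : R) (k : nat) : 0 <= s ->
  s ^+ k / k`!%:R <= (expR 1 * s / k%:R) ^+ k.
Proof.
move=> s0; case: k => [|k]; first by rewrite !expr0 fact0 divr1.
have k0 : 0 < k.+1%:R :> R by rewrite ltr0n.
have kX0 : 0 < k.+1%:R ^+ k.+1 :> R by exact: exprn_gt0.
rewrite 2!exprMn exprVn -mulrA mulrCA ler_wpM2l ?exprn_ge0//.
rewrite -expRM_natl mulr1 ler_pdivlMr// mulrC.
by have := @expR_ge1Dxn R k.+1%:R k (ltW k0); lra.
Qed.

(** The left side consists of the first two binomial terms of the right side. With [x] the mean of
    the earlier trials and [y] that of a new one, this is the induction step for the bound
    [S^k / k!]. *)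
Lemma exprS_mul_fact_le (R : realFieldType) (x y : R) (k : nat) :
  0 <= x -> 0 <= y ->
  x ^+ k.+1 / k.+1`!%:R + y * (x ^+ k / k`!%:R) <= (x + y) ^+ k.+1 / k.+1`!%:R.
Proof.
move=> x0 y0.
have /eqP-> : x ^+ k.+1 / k.+1`!%:R + y * (x ^+ k / k`!%:R) ==
    (x ^+ k.+1 + k.+1%:R * y * x ^+ k) / k.+1`!%:R.
  rewrite factS natrM; apply/eqP; field.
  by rewrite nat1r; apply/andP; split; rewrite gt_eqF// ltr0n ?fact_gt0.
rewrite ler_wpM2r ?invr_ge0 ?ler0n//.
elim: k => [|k IHk]; first by rewrite !expr1 expr0 mulr1 mul1r.
rewrite [leRHS]exprSr; apply: le_trans (ler_wpM2r _ IHk); last exact: addr_ge0.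
have -> : (x ^+ k.+1 + k.+1%:R * y * x ^+ k) * (x + y) =
   x ^+ k.+2 + k.+2%:R * y * x ^+ k.+1 + k.+1%:R * (y ^+ 2 * x ^+ k).
  by rewrite -[k.+2%:R]natr1 !exprS; ring.
by rewrite lerDl mulr_ge0// mulr_ge0 ?exprn_ge0.
Qed.

(** Discrete form of integrating [a * t^(-(a + 1))] over [[n, n + 1]]; it follows from
    [1 + x <= exp x] and [ln (1 - u) <= - u] with [u = 1 / (n + 1)]. *)
Lemma powR_telescope (R : realType) (a : R) (n : nat) : 0 < a -> (0 < n)%N ->
  a * n.+1%:R `^ (- (a + 1)) <= n%:R `^ (- a) - n.+1%:R `^ (- a).
Proof.
move=> a0 n0.
have n0' : (0 : R) < n%:R by rewrite ltr0n.
have n1 : (0 : R) < n.+1%:R by rewrite ltr0n.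
rewrite opprD powRD; last by rewrite (gt_eqF n1) implybT.
rewrite powR_inv1 ?(ltW n1)//.
have -> : n%:R `^ (- a) =
    n.+1%:R `^ (- a) * expR (- a * (ln n%:R - ln n.+1%:R)) :> R.
  rewrite /powR !gt_eqF// -expRD; congr expR; lra.
rewrite -[X in _ - X]mulr1 -mulrBr mulrCA ler_wpM2l ?powR_ge0//.
have iv : n.+1%:R^-1 < 1 :> R by rewrite invf_lt1// ltr1n.
have -> : ln n%:R = ln n.+1%:R + ln (1 - n.+1%:R^-1) :> R.
  rewrite -lnM ?posrE ?subr_gt0// mulrBr mulr1 divff ?gt_eqF//.
  by rewrite -natr1 addrK.
rewrite lerBrDr; apply: le_trans (expR_ge1Dx _).
rewrite addrAC subrr add0r addrC lerD2l mulNr -mulrN ler_wpM2l ?(ltW a0)//.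
by rewrite lerNr; apply: le_ln1Dx; rewrite ltrN2.
Qed.

Lemma sum_powR_le (R : realType) (a : R) (n M : nat) : 0 < a -> (0 < n)%N ->
  \sum_(i < M) (n.+1 + i)%:R `^ (- (a + 1)) <= n%:R `^ (- a) / a.
Proof.
move=> a0 n0; rewrite ler_pdivlMr// mulrC mulr_sumr.
apply: (@le_trans _ _ (n%:R `^ (- a) - (n + M)%:R `^ (- a))); last first.
  by rewrite gerBl powR_ge0.
elim: M => [|M IHM]; first by rewrite big_ord0 addn0 subrr.
rewrite big_ord_recr/=.
have := @powR_telescope R a (n + M) a0; rewrite addn_gt0 n0 => /(_ isT).
by move: IHM; rewrite addnS addSn; lra.
Qed.

(** * Counting successes among independent events *)

Section hits.
Context d (T : measurableType d) (R : realType) (P : probability T R).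

Definition hits (A : nat -> set T) (M : nat) (w : T) : nat :=
  \sum_(j < M) (w \in A j).

Lemma hitsS A M w : hits A M.+1 w = (hits A M w + (w \in A M))%N.
Proof. by rewrite /hits big_ord_recr. Qed.

Lemma hits_leq A M N w : (M <= N)%N -> (hits A M w <= hits A N w)%N.
Proof.
move=> /subnK <-; elim: (N - M)%N => // n IHn.
by rewrite addSn hitsS; apply: leq_trans IHn (leq_addr _ _).
Qed.

Lemma hits_shift A N M w :
  (hits A M w <= N + hits (fun j => A (N + j)%N) M w)%N.
Proof.
apply: (leq_trans (hits_leq A w (leq_addl N M))).
rewrite /hits big_split_ord/= leq_add2r -[leqRHS]card_ord -sum1_card.
by apply: leq_sum => i _; case: (_ \in _).
Qed.

(** Recursion on the last trial; the two events may overlap, but a union bound is all that is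
    needed. *)
Lemma hits_geS A M k :
  [set w | (k.+1 <= hits A M.+1 w)%N] =
  [set w | (k.+1 <= hits A M w)%N] `|` A M `&` [set w | (k <= hits A M w)%N].
Proof.
apply/seteqP; split => w /=; rewrite hitsS.
- case: (boolP (w \in A M)) => [/set_mem Aw|_]; last by rewrite addn0; left.
  by rewrite addn1 ltnS; right.
- move=> [h|[/mem_set-> h]]; first by rewrite (leq_trans h)// leq_addr.
  by rewrite addn1 ltnS.
Qed.

Lemma hits_ge0 A M : [set w | (0 <= hits A M w)%N] = setT.
Proof. by apply/seteqP; split. Qed.

Lemma hits0_gt0 A k : [set w | (k.+1 <= hits A 0 w)%N] = set0.
Proof. by apply/seteqP; split => // w /=; rewrite /hits big_ord0. Qed.

Lemma measurable_hits_ge A M k : (forall j, measurable (A j)) ->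
  measurable [set w | (k <= hits A M w)%N].
Proof.
move=> mA; elim: M k => [|M IHM] [|k]; rewrite ?hits_ge0 ?hits0_gt0//.
by rewrite hits_geS; apply: measurableU => //; apply: measurableI.
Qed.

(** Duplicate-free sequences, rather than finite sets, let an induction add one event by [::]. *)
Definition indep_events (A : nat -> set T) (p : nat -> R) :=
  forall s : seq nat, uniq s ->
    P (\big[setI/setT]_(j <- s) A j) = (\prod_(j <- s) p j)%:E.

(* Intersecting with further events [A j], [j >= M], makes the induction on [M]
   go through without having to prove that [A M] is independent of the count. *)
Lemma measure_hits_ge_le A p M k (s : seq nat) :
  (forall j, measurable (A j)) -> (forall j, 0 <= p j) -> indep_events A p ->
  uniq s -> (forall j, j \in s -> (M <= j)%N) ->
  (P (\big[setI/setT]_(j <- s) A j `&` [set w | (k <= hits A M w)%N]) <=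
    (\prod_(j <- s) p j * ((\sum_(j < M) p j) ^+ k / k`!%:R))%:E)%E.
Proof.
move=> mA p0 Aind; have mB s' : measurable (\big[setI/setT]_(j <- s') A j).
  exact: bigsetI_measurable.
elim: M k s => [|M IHM] [|k] s us sM;
  rewrite ?hits_ge0 ?setIT ?Aind ?expr0 ?fact0 ?divr1 ?mulr1//.
  by rewrite hits0_gt0 setI0 measure0 big_ord0 expr0n mul0r mulr0.
(* In the second half of the union [A M] joins the list, so the induction hypothesis applies to [s]
   and to [M :: s]. *)
rewrite hits_geS setIUr setIA -[X in _ `|` X `&` _]setIC.
rewrite -[A M `&` _]/(A M `&` _) -(big_cons _ _ M s xpredT A).
have Ms : M \notin s by apply/negP => /sM; rewrite ltnn.
apply: (le_trans (measureU2 _ _ _)).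
- by apply: measurableI => //; exact: measurable_hits_ge.
- by apply: measurableI => //; exact: measurable_hits_ge.
apply: (le_trans (leeD (IHM k.+1 s us _) (IHM k (M :: s) _ _))).
- by move=> j /sM/ltnW.
- by rewrite /= Ms us.
- by move=> j; rewrite inE => /predU1P[->//|/sM/ltnW].
rewrite -EFinD lee_fin big_cons big_ord_recr/=.
rewrite [X in _ + X](_ : _ = \prod_(j <- s) p j *
  (p M * ((\sum_(j < M) p j) ^+ k / k`!%:R))); last by ring.
rewrite -mulrDr ler_wpM2l ?prodr_ge0//.
by apply: exprS_mul_fact_le => //; exact: sumr_ge0.
Qed.

Lemma indep_events_shift A p N : indep_events A p ->
  indep_events (fun j => A (N + j)%N) (fun j => p (N + j)%N).
Proof.
move=> Aind s us.
have := Aind (map (addn N) s); rewrite !big_map map_inj_uniq//.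
  by apply.
exact: addnI.
Qed.

(** The first [N] trials supply at most [N] of the [m] successes. The bound on the rest is uniform
    in [M], so continuity from below carries it to the union. *)
Lemma measure_bigcup_hits_ge_le A p N k m (S : R) :
  (forall j, measurable (A j)) -> (forall j, 0 <= p j) -> indep_events A p ->
  (k + N <= m)%N -> (forall M, \sum_(i < M) p (N + i)%N <= S) ->
  (P (\bigcup_M [set w | (m <= hits A M w)%N]) <= (S ^+ k / k`!%:R)%:E)%E.
Proof.
move=> mA p0 Aind kNm leS.
have mF M : measurable [set w | (m <= hits A M w)%N].
  exact: measurable_hits_ge.
have ndF : {homo (fun M => [set w | (m <= hits A M w)%N]) : x y /
    (x <= y)%N >-> (x <= y)%O}.
  move=> x y xy; apply/subsetPset => w /= h.
  by apply: leq_trans h (hits_leq _ _ xy).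
have cF := @nondecreasing_cvg_mu _ _ _ P _ mF (bigcupT_measurable _ mF) ndF.
rewrite -(cvg_lim _ cF)//; apply: lime_le.
  by apply/cvg_ex; eexists; exact: cF.
apply: nearW => M /=.
have mA' j : measurable (A (N + j)%N) by [].
have le1 : (P [set w | (k <= hits (fun j => A (N + j)%N) M w)%N] <=
    ((\sum_(j < M) p (N + j)%N) ^+ k / k`!%:R)%:E)%E.
  have := @measure_hits_ge_le _ _ M k [::] mA' (fun j => p0 _)
    (indep_events_shift N Aind) isT.
  by rewrite !big_nil setTI mul1r; apply.
apply: (le_trans _ (le_trans le1 _)); first apply: le_measure.
- by rewrite inE.
- by rewrite inE; exact: measurable_hits_ge.
- move=> w /= h; rewrite -(leq_add2l N) addnC.
  by apply: (leq_trans kNm); apply: (leq_trans h); exact: hits_shift.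
rewrite lee_fin ler_wpM2r ?invr_ge0 ?ler0n// lerXn2r ?nnegrE ?sumr_ge0//.
by apply: le_trans (leS M); exact: sumr_ge0.
Qed.

Lemma measure_bigcup_hits_ge_ge A p N m :
  (forall j, measurable (A j)) -> indep_events A p ->
  ((\prod_(i < m) p (N + i)%N)%:E <=
    P (\bigcup_M [set w | (m <= hits A M w)%N]))%E.
Proof.
move=> mA Aind.
have := indep_events_shift N Aind (iota_uniq 0 (m - 0)).
rewrite -/(index_iota 0 m) !big_mkord => <-.
apply: le_measure; rewrite ?inE.
- exact: bigsetI_measurable.
- by apply: bigcupT_measurable => M; exact: measurable_hits_ge.
move=> w; rewrite -(bigcap_mkord m (fun i => A (N + i)%N)) => h.
exists (N + m)%N => //=; rewrite /hits big_split_ord/=.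
apply: leq_trans (leq_addl _ _); rewrite -{1}[m]card_ord -sum1_card.
by apply: leq_sum => i _; rewrite mem_set//; apply: (h i) => /=.
Qed.

End hits.

(** * Asymptotic estimates, and the tail event in terms of counts *)

Lemma near_pinfty_ln_ge (R : realType) (K : R) : \forall z \near +oo, K <= ln z.
Proof.
near=> z; have Kz : expR K <= z.
  by near: z; apply: nbhs_pinfty_ge; exact: num_real.
by rewrite -[leLHS]expRK ler_ln ?posrE ?expR_gt0//
  (lt_le_trans _ Kz)// expR_gt0.
Unshelve. all: by end_near. Qed.

(** The constant [L] is harmless: after normalisation it contributes only [theta * L / ln z]. *)
Lemma near_pinfty_div_xlnx (R : realType) (theta L alpha e : R) : 0 < e ->
  \forall z \near +oo,
    `|(z * ln z)^-1 * (theta * z * (L - alpha * ln z)) + theta * alpha| <= e.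
Proof.
move=> e0; near=> z.
have z0 : 0 < z by near: z; apply: nbhs_pinfty_gt; exact: num_real.
have l1 : 1 <= ln z by near: z; exact: near_pinfty_ln_ge.
have le : `|theta * L| / e <= ln z by near: z; exact: near_pinfty_ln_ge.
have l0 : 0 < ln z by lra.
have -> : (z * ln z)^-1 * (theta * z * (L - alpha * ln z)) + theta * alpha =
    theta * L / ln z.
  by field; rewrite (gt_eqF z0) (gt_eqF l0).
rewrite normrM normfV (gtr0_norm l0) ler_pdivrMr//.
by move: le; rewrite ler_pdivrMr//; lra.
Unshelve. all: by end_near. Qed.

Lemma asymp_equiv_bounds (R : realType) (p : nat -> R) (c alpha : R) :
  0 < c -> asymp_equiv p (fun n : nat => c * n%:R `^ (- alpha)) ->
  exists2 N : nat, (0 < N)%N & forall n, (N <= n)%N ->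
    c / 2 * n%:R `^ (- alpha) <= p n <= 2 * c * n%:R `^ (- alpha).
Proof.
move=> c0 /cvgr_dist_lt /(_ (1/2)); rewrite divr_gt0// => /(_ isT).
(* Starting at [N.+1] keeps [n] positive, so that the comparison sequence can be divided by. *)
move=> -[N _ HN]; exists N.+1 => // n Nn.
have n0 : (0 : R) < n%:R by rewrite ltr0n; apply: leq_trans Nn.
have b0 : 0 < c * n%:R `^ (- alpha) by rewrite mulr_gt0// powR_gt0.
have /= := HN n (ltnW Nn); set b := c * _ in b0 *.
have -> : p n = p n / b * b by rewrite divfK ?gt_eqF.
rewrite mulfK ?gt_eqF// mulrAC -[2 * c * _]mulrA -/b.
by rewrite ltr_norml => /andP[h1 h2]; apply/andP; split; nra.
Qed.

(** A nonnegative series exceeds [z] exactly when some partial sum does, and partial sums are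
    integers, so exceeding [z] means reaching [Num.trunc z + 1]. *)
Lemma lt_nneseries_bigcup_hits d (T : measurableType d) (R : realType)
    (X : nat -> T -> R) (z : R) :
  (forall j w, X j w = 0 \/ X j w = 1) -> 0 <= z ->
  [set w | (z%:E < \sum_(0 <= j <oo) (X j w)%:E)%E] =
  \bigcup_M [set w |
    ((Num.trunc z).+1 <= hits (fun j => [set w | X j w = 1%R]) M w)%N].
Proof.
move=> X01 z0; set A := fun j => [set w | X j w = 1].
have X0 w j : (0 <= (X j w)%:E)%E by rewrite lee_fin; case: (X01 j w) => ->.
have sumE M w : (\sum_(0 <= j < M) (X j w)%:E = (hits A M w)%:R%:E)%E.
  rewrite sumEFin big_mkord /hits natr_sum; congr EFin.
  apply: eq_bigr => j _; case: (X01 j w) => Xw.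
    by rewrite memNset// /A/= Xw => /eqP; rewrite eq_sym oner_eq0.
  by rewrite mem_set.
apply/seteqP; split => w /=.
- apply: contraPP => noM; apply/negP; rewrite -leNgt.
  apply: lime_le; first exact: is_cvg_nneseries.
  apply: nearW => M; rewrite sumE lee_fin leNgt; apply/negP => zM.
  by apply: noM; exists M => //=; rewrite truncn_lt_nat.
- move=> [M _ /=]; rewrite truncn_lt_nat// -lte_fin -sumE.
  move=> /lt_le_trans; apply; exact: nneseries_lim_ge.
Qed.

(** * Two-sided bounds on the logarithm of the tail *)

Section tail.
Context d (T : measurableType d) (R : realType) (P : probability T R).
Variables (A : nat -> set T) (p : nat -> R) (c alpha : R) (N : nat).
Hypotheses (mA : forall j, measurable (A j)) (p_ge0 : forall j, 0 <= p j)
  (Aind : indep_events P A p) (c_gt0 : 0 < c) (alpha_gt1 : 1 < alpha)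
  (N_gt0 : (0 < N)%N).

Let alpha_gt0 : 0 < alpha.
Proof. exact: lt_trans alpha_gt1. Qed.

Let tail (z : R) :=
  fine (P (\bigcup_M [set w | ((Num.trunc z).+1 <= hits A M w)%N])).

Let tailE z :
  P (\bigcup_M [set w | ((Num.trunc z).+1 <= hits A M w)%N]) = (tail z)%:E.
Proof.
rewrite fineK//; apply: fin_num_measure; apply: bigcupT_measurable => M.
exact: measurable_hits_ge.
Qed.

(** Positivity of the tail is recorded too: the upper bound needs it, [ln] being monotone only on
    positive numbers. *)
Lemma ln_tail_ge (theta : R) :
  (forall n, (N <= n)%N -> c / 2 * n%:R `^ (- alpha) <= p n) -> 1 < theta ->
  exists L, \forall z \near +oo,
    0 < tail z /\ theta * z * (L - alpha * ln z) <= ln (tail z).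
Proof.
(* This is [ln b + alpha * ln z], where [b] below bounds each [p (N + i)] from below, as
   [N + i <= 2 * z]. *)
move=> p_ge theta1; exists (ln (c / 2) - alpha * ln 2); near=> z.
have z0 : 0 < z by near: z; apply: nbhs_pinfty_gt; exact: num_real.
have c2 : 0 < c / 2 by rewrite divr_gt0.
pose m := (Num.trunc z).+1; pose b := c / 2 * (2 * z) `^ (- alpha).
have /andP[tz _] := truncn_itv (ltW z0).
have b0 : 0 < b by rewrite mulr_gt0// powR_gt0// mulr_gt0.
have tail_b : b ^+ m <= tail z.
  rewrite -lee_fin -tailE.
  apply: le_trans (measure_bigcup_hits_ge_ge N m mA Aind); rewrite lee_fin.
  rewrite -[m in b ^+ m]card_ord -prodr_const; apply: ler_prod => i _.
  rewrite (ltW b0)/=; apply: le_trans (p_ge _ (leq_addr _ _)).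
  have Ni : 0 < (N + i)%:R :> R by rewrite ltr0n addn_gt0 N_gt0.
  rewrite ler_wpM2l ?(ltW c2)// !powRN lef_pV2 ?posrE ?powR_gt0 ?mulr_gt0//.
  rewrite ge0_ler_powR ?nnegrE ?(ltW Ni) ?mulr_ge0 ?(ltW z0)//; first exact: ltW.
  have Nz : N%:R <= z by near: z; apply: nbhs_pinfty_ge; exact: num_real.
  have : (i%:R : R) <= (Num.trunc z)%:R by rewrite ler_nat -ltnS.
  by rewrite natrD; lra.
have tail0 : 0 < tail z by apply: lt_le_trans tail_b; exact: exprn_gt0.
split => //; apply: (@le_trans _ _ (ln (b ^+ m))); last first.
  by rewrite ler_ln ?posrE ?exprn_gt0.
rewrite lnXn// -[ln _ *+ _]mulr_natl.
have -> : ln b = ln (c / 2) - alpha * ln 2 - alpha * ln z.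
  rewrite /b lnM ?posrE ?powR_gt0 ?mulr_gt0// ln_powR (@lnM R 2 z) ?posrE//.
  ring.
set L := _ - _ * ln 2.
have Lz : L - alpha * ln z <= 0.
  rewrite subr_le0 -ler_pdivrMl//.
  by near: z; exact: near_pinfty_ln_ge.
(* The common factor is nonpositive, so it remains to see that [m <= z + 1 <= theta * z]. *)
rewrite ler_wnM2r//.
rewrite -natr1; apply: (@le_trans _ _ (z + 1)); first by lra.
have : (theta - 1)^-1 <= z by near: z; apply: nbhs_pinfty_ge; exact: num_real.
by rewrite -[_^-1]mul1r ler_pdivrMr ?subr_gt0//; lra.
Unshelve. all: by end_near. Qed.

Lemma ln_tail_le (e : R) :
  (forall n, (N <= n)%N -> p n <= 2 * c * n%:R `^ (- alpha)) ->
  0 < e -> 0 < 1 - 2 * e ->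
  exists L, \forall z \near +oo, 0 < tail z ->
    ln (tail z) <= (1 - 2 * e) * z * (L - alpha * ln z).
Proof.
move=> p_le e0; set theta := 1 - 2 * e => theta0.
pose a := alpha - 1; have a0 : 0 < a by rewrite subr_gt0.
have [B B0 BE] : exists2 B : R, 0 < B & B = 2 * c / a.
  by exists (2 * c / a) => //; rewrite divr_gt0// mulr_gt0.
(* The constants of [ln (expR 1 * S / k)]: by [n >= e * z] and [k >= theta * z] the remaining part
   is at most [- a * ln z - ln z], that is [- alpha * ln z]. *)
exists (1 + ln B - a * ln e - ln theta); near=> z; move=> tail0.
have z0 : 0 < z by near: z; apply: nbhs_pinfty_gt; exact: num_real.
have ez0 : 0 < e * z by exact: mulr_gt0.
have tz0 : 0 < theta * z by exact: mulr_gt0.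
(* Since [theta + e = 1 - e], a spare [e * z >= 3] absorbs the rounding in [k + n.+1]; the next
   bound yields [N <= n]. *)
have z3 : 3 / e <= z by near: z; apply: nbhs_pinfty_ge; exact: num_real.
have Nz : N%:R / e <= z by near: z; apply: nbhs_pinfty_ge; exact: num_real.
pose n := (Num.trunc (e * z)).+1; pose k := (Num.trunc (theta * z)).+1.
have /andP[n1 n2] := truncn_itv (ltW ez0).
have /andP[k1 k2] := truncn_itv (ltW tz0).
have /andP[_ m2] := truncn_itv (ltW z0).
have knm : (k + n.+1 <= (Num.trunc z).+1)%N.
  apply: ltnW; rewrite -(ltr_nat R) natrD /k /n -!natr1.
  move: z3 m2; rewrite ler_pdivrMr// -natr1 => z3 m2.
  rewrite /theta in k1; nra.
pose S := B * n%:R `^ (- a).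
have n0 : (0 : R) < n%:R by rewrite ltr0n.
have k0 : (0 : R) < k%:R by rewrite ltr0n.
have S0 : 0 < S by rewrite mulr_gt0// powR_gt0.
have sum_le M : \sum_(i < M) p (n.+1 + i)%N <= S.
  apply: (@le_trans _ _ (2 * c * \sum_(i < M) (n.+1 + i)%:R `^ (- (a + 1)))).
    rewrite mulr_sumr; apply: ler_sum => i _; rewrite subrK; apply: p_le.
    apply: leq_trans (leq_addr _ _); apply: leqW; rewrite -(ler_nat R).
    by move: Nz; rewrite ler_pdivrMr// mulrC => /le_trans; apply; exact: ltW.
  have -> : S = 2 * c * (n%:R `^ (- a) / a) by rewrite /S BE mulrAC mulrA.
  rewrite ler_wpM2l ?sum_powR_le//.
  by rewrite mulr_ge0// ltW.
have := measure_bigcup_hits_ge_le mA p_ge0 Aind knm sum_le.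
rewrite tailE lee_fin => /le_trans/(_ (expr_div_fact_le k (ltW S0))) tail_le.
have eS0 : 0 < expR 1 * S / k%:R by rewrite divr_gt0// mulr_gt0// expR_gt0.
apply: (@le_trans _ _ (ln ((expR 1 * S / k%:R) ^+ k))).
  by rewrite ler_ln ?posrE// exprn_gt0.
rewrite lnXn// -[ln _ *+ _]mulr_natl !lnM ?posrE ?invr_gt0 ?mulr_gt0 ?expR_gt0
  ?powR_gt0//.
rewrite lnV ?posrE// ln_powR expRK.
have ln_n : ln e + ln z <= ln n%:R.
  by rewrite -lnM ?posrE// ler_ln ?posrE// ltW.
have ln_k : ln theta + ln z <= ln k%:R.
  by rewrite -lnM ?posrE// ler_ln ?posrE// ltW.
set L := 1 + _ - _ - _.
have Lz : L - alpha * ln z <= 0.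
  rewrite subr_le0 -ler_pdivrMl//.
  by near: z; exact: near_pinfty_ln_ge.
apply: (@le_trans _ _ (k%:R * (L - alpha * ln z))).
  rewrite ler_wpM2l ?(ltW k0)// /L.
  have -> : alpha = a + 1 by rewrite subrK.
  by have := ler_wpM2l (ltW a0) ln_n; lra.
by rewrite ler_wnM2r// ltW.
Unshelve. all: by end_near. Qed.

End tail.

(** * Squeezing the normalised logarithm *)

Theorem theorem2 (R : realType) (d : measure_display) (T : measurableType d)
    (P : probability T R) (I : int -> {RV P >-> R}) (p : int -> R)
    (c alpha : R)
    (I01 : forall (j : int) (w : T), I j w = 0 \/ I j w = 1)
    (Iindep : independent_RVs I)
    (pE : forall j : int, P [set w | I j w = 1] = (p j)%:E)
    (c_gt0 : 0 < c) (alpha_gt1 : 1 < alpha)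
    (p_asymp : asymp_equiv (fun n : nat => p n%:Z)
                           (fun n : nat => c * n%:R `^ (- alpha))) :
  (z * ln z)^-1 *
    ln (fine (P [set w | (z%:E < \sum_(0 <= j <oo) (I j%:Z w)%:E)%E]))
    @[z --> +oo] --> - alpha.
Proof.
pose A (j : nat) := [set w | I j%:Z w = 1].
have preA j : A j = I j%:Z @^-1` [set 1] by [].
have mA j : measurable (A j) by rewrite preA; exact: measurable_funPTI.
have p0 (j : nat) : 0 <= p j%:Z by rewrite -lee_fin -pE; exact: measure_ge0.
have Aind : indep_events P A (fun j => p j%:Z).
  move=> s us; have us' : uniq (map Posz s) by rewrite map_inj_uniq// => ? ? [].
  have := Iindep [fset j in map Posz s]%fset (fun=> [set 1])
    (fun _ _ => measurable_set1 _).
  rewrite bigcap_fset.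
  have perm : perm_eq [fset j in map Posz s]%fset (map Posz s).
    by apply: uniq_perm => // j; rewrite inE.
  rewrite !(perm_big _ perm)/= !big_map => ->.
  by rewrite -prodEFin; apply: eq_bigr => j _; rewrite -pE.
have [N N0 Np] := asymp_equiv_bounds c_gt0 p_asymp.
apply/cvgrPdist_le => delta delta0.
have a0 : 0 < alpha by lra.
(* Half of [delta] pays for replacing [alpha] by [th1 * alpha] or [th2 * alpha], the other half for
   [L1] or [L2]. *)
pose th1 := 1 + delta / (2 * alpha).
have th1_gt1 : 1 < th1 by rewrite ltrDl divr_gt0// mulr_gt0.
have th1E : th1 * alpha = alpha + delta / 2.
  by rewrite /th1; field; rewrite gt_eqF.
have [e [e0 e1 th2E]] : exists e, [/\ 0 < e, 0 < 1 - 2 * e &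
    alpha - delta / 2 <= (1 - 2 * e) * alpha].
  (* This makes [2 * e * alpha <= delta / 2], and [e < 1 / 4] however large [delta] is. *)
  pose e := delta / (4 * (alpha + delta)); exists e.
  have ad0 : 0 < 4 * (alpha + delta) by rewrite mulr_gt0// addr_gt0.
  have e0 : 0 < e by rewrite divr_gt0.
  have eE : e * (4 * (alpha + delta)) = delta by rewrite /e divfK// gt_eqF.
  by split => //; nra.
pose th2 := 1 - 2 * e.
pose tail (z : R) :=
  fine (P (\bigcup_M [set w | ((Num.trunc z).+1 <= hits A M w)%N])).
have [L1 HL1] := ln_tail_ge mA Aind c_gt0 alpha_gt1 N0
  (fun n Nn => proj1 (andP (Np n Nn))) th1_gt1.
have [L2 HL2] := ln_tail_le mA p0 Aind c_gt0 alpha_gt1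
  (fun n Nn => proj2 (andP (Np n Nn))) e0 e1.
have d2 : 0 < delta / 2 by rewrite divr_gt0.
near=> z.
have z0 : 0 < z by near: z; apply: nbhs_pinfty_gt; exact: num_real.
have l1 : 1 <= ln z by near: z; exact: near_pinfty_ln_ge.
have zl0 : 0 <= (z * ln z)^-1 by rewrite invr_ge0 mulr_ge0; lra.
rewrite (lt_nneseries_bigcup_hits (X := fun j => I j%:Z))// ?(ltW z0)//.
rewrite -/(tail z).
have [t0 ge] : 0 < tail z /\ th1 * z * (L1 - alpha * ln z) <= ln (tail z).
  by near: z; exact: HL1.
have le : ln (tail z) <= th2 * z * (L2 - alpha * ln z).
  by move: t0; near: z; exact: HL2.
have : `|(z * ln z)^-1 * (th2 * z * (L2 - alpha * ln z)) + th2 * alpha|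
    <= delta / 2 by near: z; exact: near_pinfty_div_xlnx.
have : `|(z * ln z)^-1 * (th1 * z * (L1 - alpha * ln z)) + th1 * alpha|
    <= delta / 2 by near: z; exact: near_pinfty_div_xlnx.
(* Generalising the products leaves a linear problem. *)
move: (ler_wpM2l zl0 ge) (ler_wpM2l zl0 le) th1E th2E; rewrite !ler_norml.
move: (th1 * alpha) (th2 * alpha) (_ * (th1 * _ * _)) (_ * (th2 * _ * _))
  (_ * ln (tail z)) => a1 a2 x1 x2 x le1 le2 a1E a2E /andP[lb _] /andP[_ ub].
by apply/andP; split; lra.
Unshelve. all: by end_near. Qed.
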